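(* Let $F:\mathbb{R}^d\to\mathbb{R}^d$ be monotone and differentiable with $\|DF(z)-DF(z')\|_{\mathrm{op}}\le L_2\|z-z'\|$ for all $z,z'\in\mathbb{R}^d$, where $L_2>0$; let $H:\mathbb{R}^d\rightrightarrows\mathbb{R}^d$ be maximally monotone, and let $z^*$ satisfy $0\in F(z^* )+H(z^* )$. Let $z_0\in\operatorname{dom}(H)$ and $\varepsilon>0$. Then the AEP Newton method (defined in the context) returns a point $\widehat z$ satisfying $\mathrm{res}^{\mathrm{tan}}(\widehat z)\le\varepsilon$ after at most $$T:=\left\lceil\left(\frac{16L_2\|z_0-z^*\|^2}{\varepsilon}\right)^{2/5}\right\rceil$$ outer iterations.
   Context: Norms are Euclidean; $\operatorname{dom}(H)=\{z:H(z)\neq\emptyset\}$. The tangent residual is $\mathrm{res}^{\mathrm{tan}}(z)=\inf_{v\in H(z)}\|F(z)+v\|$. AEP Newton method. Input: $z_0\in\operatorname{dom}(H)$, $\varepsilon>0$, $L_2>0$. Choose $v_0\in H(z_0)$ and set $A_0=0$. For $k=0,1,2,\dots$: (1) If $\|F(z_k)+v_k\|\le\varepsilon$, stop and return $z_k$. (2) Otherwise run the line search. For a trial step size $a>0$, a trial evaluation consists of computing $$z_{k+1/2}(a)=\frac{a}{A_k+a}z_0+\frac{A_k}{A_k+a}\bigl(z_k-a(F(z_k)+v_k)\bigr),$$ the affine model $P_{k,a}(z)=F(z_{k+1/2}(a))+DF(z_{k+1/2}(a))(z-z_{k+1/2}(a))$, the unique solution $z_{k+1}(a)$ of $$0\in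 aP_{k,a}(z_{k+1}(a))+aH(z_{k+1}(a))+z_{k+1}(a)-\Bigl(\frac{a}{A_k+a}z_0+\frac{A_k}{A_k+a}z_k\Bigr),$$ and $$v_{k+1}(a)=\frac1a\Bigl(\frac{a}{A_k+a}z_0+\frac{A_k}{A_k+a}z_k-z_{k+1}(a)\Bigr)-P_{k,a}(z_{k+1}(a))\in H(z_{k+1}(a)).$$ The merit function is $\phi_k(a)=L_2\,a\,\|z_{k+1}(a)-z_{k+1/2}(a)\|$ for $a>0$, $\phi_k(0)=0$. The upper trial value is $$\bar a_k=\max\left\{\frac{2A_k\|F(z_k)+v_k\|}{\varepsilon},\ \sqrt{\frac{2(1+\sqrt2)}{L_2\varepsilon}}\right\}.$$ First evaluate the trial $a=\bar a_k$. If $\phi_k(\bar a_k)\le\sqrt2$, the whole method terminates and returns $z_{k+1}(\bar a_k)$. Otherwise set $a^-=0$, $a^+=\bar a_k$ and repeat (bisection phase): evaluate the trial $a=(a^-+a^+)/2$; if $\phi_k(a)<1$ set $a^-\leftarrow a$; if $\phi_k(a)>\sqrt2$ set $a^+\leftarrow a$; otherwise accept $a_k=a$ and leave the loop. (3) After acceptance set $z_{k+1/2}=z_{k+1/2}(a_k)$, $z_{k+1}=z_{k+1}(a_k)$, $v_{k+1}=v_{k+1}(a_k)$, $A_{k+1}=A_k+a_k$. An outer iteration means one accepted update $k\to k+1$. *)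

(* Defs.v *)
From mathcomp Require Import all_boot all_order all_algebra.
From mathcomp Require Import all_classical all_reals all_analysis.
Set Implicit Arguments.
Unset Strict Implicit.
Unset Printing Implicit Defensive.
Import Order.TTheory GRing.Theory Num.Theory.
Import numFieldNormedType.Exports.
Local Open Scope classical_set_scope.
Local Open Scope ring_scope.

(* The library norm `|x| on 'rV[R]_d is the sup norm, hence a separate Euclidean
   norm. Differentiability and the differential 'd F z do not depend on which of
   the two (equivalent) norms is used. *)
Definition dotv (R : realType) (d : nat) (x y : 'rV[R]_d) : R :=
  \sum_(i < d) x 0 i * y 0 i.

Definition enorm (R : realType) (d : nat) (x : 'rV[R]_d) : R :=
  Num.sqrt (dotv x x).

(* Valued in \bar R so that no boundedness proof is built into the definition. *)
Definition opnorm (R : realType) (d : nat) (A : 'rV[R]_d -> 'rV[R]_d) : \bar R :=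
  ereal_sup [set (enorm (A x))%:E | x in [set x | enorm x <= 1]].

Definition monotone_map (R : realType) (d : nat) (F : 'rV[R]_d -> 'rV[R]_d) :=
  forall x y, 0 <= dotv (F x - F y) (x - y).

Definition monotone_op (R : realType) (d : nat) (H : 'rV[R]_d -> set 'rV[R]_d) :=
  forall x y u v, H x u -> H y v -> 0 <= dotv (u - v) (x - y).

Definition maximally_monotone (R : realType) (d : nat)
    (H : 'rV[R]_d -> set 'rV[R]_d) :=
  monotone_op H /\
  forall G : 'rV[R]_d -> set 'rV[R]_d,
    monotone_op G -> (forall x, H x `<=` G x) -> forall x, G x `<=` H x.

Definition op_dom (R : realType) (d : nat) (H : 'rV[R]_d -> set 'rV[R]_d) :
    set 'rV[R]_d :=
  [set z | H z !=set0].

(* An extended real: the value is +oo outside op_dom H (the real-valued inf of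
   the library is 0 on the empty set). *)
Definition res_tan (R : realType) (d : nat) (F : 'rV[R]_d -> 'rV[R]_d)
    (H : 'rV[R]_d -> set 'rV[R]_d) (z : 'rV[R]_d) : \bar R :=
  ereal_inf [set (enorm (F z + v))%:E | v in H z].

(* In the trial computations, z, v, A are z_k, v_k, A_k and a is the trial step. *)

Definition anchored (R : realType) (d : nat) (z0 : 'rV[R]_d) (A a : R)
    (y : 'rV[R]_d) : 'rV[R]_d :=
  (a / (A + a)) *: z0 + (A / (A + a)) *: y.

Definition half_point (R : realType) (d : nat) (F : 'rV[R]_d -> 'rV[R]_d)
    (z0 z v : 'rV[R]_d) (A a : R) : 'rV[R]_d :=
  anchored z0 A a (z - a *: (F z + v)).

Definition affine_model (R : realType) (d : nat) (F : 'rV[R]_d -> 'rV[R]_d)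
    (w x : 'rV[R]_d) : 'rV[R]_d :=
  F w + 'd F w (x - w).

Definition trial_inclusion (R : realType) (d : nat) (F : 'rV[R]_d -> 'rV[R]_d)
    (H : 'rV[R]_d -> set 'rV[R]_d) (z0 z v : 'rV[R]_d) (A a : R)
    (x : 'rV[R]_d) : Prop :=
  [set a *: affine_model F (half_point F z0 z v A a) x + a *: u + x
         - anchored z0 A a z | u in H x] 0.

(* "x is the unique solution": a trial without a unique solution has no value,
   and an execution that needs it is stuck. *)
Definition trial_point (R : realType) (d : nat) (F : 'rV[R]_d -> 'rV[R]_d)
    (H : 'rV[R]_d -> set 'rV[R]_d) (z0 z v : 'rV[R]_d) (A a : R)
    (x : 'rV[R]_d) : Prop :=
  unique (trial_inclusion F H z0 z v A a) x.

Definition trial_dual (R : realType) (d : nat) (F : 'rV[R]_d -> 'rV[R]_d)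
    (z0 z v : 'rV[R]_d) (A a : R) (x : 'rV[R]_d) : 'rV[R]_d :=
  a^-1 *: (anchored z0 A a z - x)
  - affine_model F (half_point F z0 z v A a) x.

Definition merit (R : realType) (d : nat) (F : 'rV[R]_d -> 'rV[R]_d) (L2 : R)
    (z0 z v : 'rV[R]_d) (A a : R) (x : 'rV[R]_d) : R :=
  L2 * a * enorm (x - half_point F z0 z v A a).

Definition upper_trial (R : realType) (d : nat) (F : 'rV[R]_d -> 'rV[R]_d)
    (eps L2 : R) (z v : 'rV[R]_d) (A : R) : R :=
  Num.max (2 * A * enorm (F z + v) / eps)
          (Num.sqrt (2 * (1 + Num.sqrt 2) / (L2 * eps))).

(* The natural number k in a state is the number of accepted updates so far. *)
Inductive aep_state (R : realType) (d : nat) : Type :=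
| Start
| Outer (k : nat) (z v : 'rV[R]_d) (A : R)
| Bisect (k : nat) (z v : 'rV[R]_d) (A am ap : R)
| Returned (k : nat) (zhat : 'rV[R]_d).
Arguments Start {R d}.

Inductive aep_step (R : realType) (d : nat) (F : 'rV[R]_d -> 'rV[R]_d)
    (H : 'rV[R]_d -> set 'rV[R]_d) (z0 : 'rV[R]_d) (eps L2 : R) :
    aep_state R d -> aep_state R d -> Prop :=
| step_init v0 :
    H z0 v0 ->
    aep_step F H z0 eps L2 Start (Outer 0 z0 v0 0)
| step_stop k z v A :
    enorm (F z + v) <= eps ->
    aep_step F H z0 eps L2 (Outer k z v A) (Returned k z)
| step_upper_return k z v A x :
    let a := upper_trial F eps L2 z v A in
    eps < enorm (F z + v) ->
    trial_point F H z0 z v A a x ->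
    merit F L2 z0 z v A a x <= Num.sqrt 2 ->
    aep_step F H z0 eps L2 (Outer k z v A) (Returned k x)
| step_upper_bisect k z v A x :
    let a := upper_trial F eps L2 z v A in
    eps < enorm (F z + v) ->
    trial_point F H z0 z v A a x ->
    Num.sqrt 2 < merit F L2 z0 z v A a x ->
    aep_step F H z0 eps L2 (Outer k z v A) (Bisect k z v A 0 a)
| step_raise k z v A am ap x :
    let a := (am + ap) / 2 in
    trial_point F H z0 z v A a x ->
    merit F L2 z0 z v A a x < 1 ->
    aep_step F H z0 eps L2 (Bisect k z v A am ap) (Bisect k z v A a ap)
| step_lower k z v A am ap x :
    let a := (am + ap) / 2 in
    trial_point F H z0 z v A a x ->
    Num.sqrt 2 < merit F L2 z0 z v A a x ->
    aep_step F H z0 eps L2 (Bisect k z v A am ap) (Bisect k z v A am a)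
| step_accept k z v A am ap x :
    let a := (am + ap) / 2 in
    trial_point F H z0 z v A a x ->
    1 <= merit F L2 z0 z v A a x <= Num.sqrt 2 ->
    aep_step F H z0 eps L2 (Bisect k z v A am ap)
      (Outer k.+1 x (trial_dual F z0 z v A a x) (A + a)).

(* Total correctness: every execution from s reaches Q after finitely many steps
   and none of them gets stuck before. *)
Inductive always_reaches (S : Type) (step : S -> S -> Prop) (Q : S -> Prop) :
    S -> Prop :=
| reaches_now s : Q s -> always_reaches step Q s
| reaches_next s :
    (exists s', step s s') ->
    (forall s', step s s' -> always_reaches step Q s') ->
    always_reaches step Q s.

Definition aep_returns (R : realType) (d : nat) (F : 'rV[R]_d -> 'rV[R]_d)
    (H : 'rV[R]_d -> set 'rV[R]_d) (z0 : 'rV[R]_d) (eps L2 : R)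
    (Q : nat -> 'rV[R]_d -> Prop) : Prop :=
  always_reaches (aep_step F H z0 eps L2)
    (fun s => if s is Returned k zhat then Q k zhat else False) Start.

(* Main.v *)
Require Import Defs.
From mathcomp Require Import all_boot all_order all_algebra.
From mathcomp Require Import all_classical all_reals all_analysis.
From mathcomp Require Import ring lra.
Import Order.TTheory GRing.Theory Num.Theory.
Import numFieldNormedType.Exports.
Local Open Scope classical_set_scope.
Local Open Scope ring_scope.
Set Implicit Arguments.
Unset Strict Implicit.
Unset Printing Implicit Defensive.

(** Write [g_k = F z_k + v_k], [D = |z_0 - z*|] and
    [V_k = A_k^2 |g_k|^2 / 2 + A_k <g_k, z_k - z_0>].  Monotonicity of [F + H]
    between [z_k] and [z_(k+1)], together with the bound [L_2 r^2 / 2] on the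
    error of the affine model ([r = |z_(k+1) - z_(k+1/2)|]) and
    [1 <= L_2 a_k r <= sqrt 2], gives
    [V_(k+1) <= V_k - A_(k+1)^2 / (4 L_2^2 a_k^4)].  Monotonicity between [z_k]
    and [z*] gives [V_k >= A_k^2 |g_k|^2 / 2 - A_k |g_k| D].  Hence
    [A_k |g_k| <= 2 D] and [sum_i A_(i+1)^2 / a_i^4 <= 2 L_2^2 D^2]; by Hoelder
    the latter forces [k^5 <= 32 L_2^2 D^2 A_k^2], so that [|g_k| > eps] is
    possible only for [k^5 <= 128 (L_2 D^2 / eps)^2].

    The trial subproblems are solvable by Minty's theorem.  A bisection phase is
    finite because the merit function tends to 0 at 0 and is Lipschitz away
    from 0, whereas an infinite phase would make it jump from below 1 to above
    [sqrt 2] on arbitrarily short intervals. *)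

(** * Euclidean geometry *)

Section Euclidean.
Context {R : realType} {d : nat}.
Implicit Types (x y z : 'rV[R]_d) (a b : R).

Lemma dotvC x y : dotv x y = dotv y x.
Proof. by apply: eq_bigr => i _; rewrite mulrC. Qed.

Lemma dotvDl x y z : dotv (x + y) z = dotv x z + dotv y z.
Proof. by rewrite /dotv -big_split; apply: eq_bigr => i _; rewrite mxE mulrDl. Qed.

Lemma dotvZl a x y : dotv (a *: x) y = a * dotv x y.
Proof. by rewrite /dotv mulr_sumr; apply: eq_bigr => i _; rewrite mxE mulrA. Qed.

Lemma dotvNl x y : dotv (- x) y = - dotv x y.
Proof. by rewrite -scaleN1r dotvZl mulN1r. Qed.

Lemma dotvDr x y z : dotv z (x + y) = dotv z x + dotv z y.
Proof. by rewrite dotvC dotvDl !(dotvC z). Qed.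

Lemma dotvZr a x y : dotv y (a *: x) = a * dotv y x.
Proof. by rewrite dotvC dotvZl dotvC. Qed.

Lemma dotvNr x y : dotv y (- x) = - dotv y x.
Proof. by rewrite dotvC dotvNl dotvC. Qed.

Definition dotvE := (dotvDl, dotvDr, dotvZl, dotvZr, dotvNl, dotvNr).

Lemma dotv0l x : dotv 0 x = 0.
Proof. by rewrite -(scale0r 0) dotvZl mul0r. Qed.

Lemma dotv_ge0 x : 0 <= dotv x x.
Proof. by apply: sumr_ge0 => i _; rewrite -expr2 sqr_ge0. Qed.

Lemma dotv_le0 x : dotv x x <= 0 -> x = 0.
Proof.
move=> x0; have /eqP := le_anti (introT andP (conj x0 (dotv_ge0 x))).
rewrite psumr_eq0 => [/allP h|i _]; last by rewrite -expr2 sqr_ge0.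
apply/rowP => i; have /= := h i (mem_index_enum i).
by rewrite mulf_eq0 orbb mxE => /eqP.
Qed.

Lemma enorm_ge0 x : 0 <= enorm x.
Proof. exact: sqrtr_ge0. Qed.

Lemma enorm_sqr x : enorm x ^+ 2 = dotv x x.
Proof. by rewrite sqr_sqrtr ?dotv_ge0. Qed.

Lemma enorm0 : enorm (0 : 'rV[R]_d) = 0.
Proof. by rewrite /enorm dotv0l sqrtr0. Qed.

Lemma enorm_le x a : 0 <= a -> (enorm x <= a) = (dotv x x <= a ^+ 2).
Proof. by move=> a0; rewrite -enorm_sqr ler_sqr ?nnegrE ?enorm_ge0. Qed.

Lemma enormZ a x : enorm (a *: x) = `|a| * enorm x.
Proof. by rewrite /enorm !dotvE mulrA -expr2 sqrtrM ?sqr_ge0// sqrtr_sqr. Qed.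

Lemma enormN x : enorm (- x) = enorm x.
Proof. by rewrite /enorm !dotvE opprK. Qed.

Lemma enormB x y : enorm (x - y) = enorm (y - x).
Proof. by rewrite -enormN opprB. Qed.

Lemma enorm_gt0 x : x != 0 -> 0 < enorm x.
Proof.
move=> x0; rewrite lt_def enorm_ge0 andbT; apply: contra x0 => /eqP h.
by apply/eqP/dotv_le0; rewrite -enorm_sqr h expr0n.
Qed.

(** Cauchy-Schwarz, by expanding the square of [enorm y *: x - enorm x *: y] and dividing by
    [enorm x * enorm y]. *)
Lemma dotv_le_enorm x y : dotv x y <= enorm x * enorm y.
Proof.
have [->|/enorm_gt0 x0] := eqVneq x 0; first by rewrite dotv0l enorm0 mul0r.
have [->|/enorm_gt0 y0] := eqVneq y 0.
  by rewrite dotvC dotv0l enorm0 mulr0.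
have := dotv_ge0 (enorm y *: x - enorm x *: y).
rewrite !dotvE (dotvC y x) -!enorm_sqr => h.
have xy0 := mulr_gt0 x0 y0.
rewrite -subr_ge0 -(pmulr_rge0 _ xy0); nra.
Qed.

Lemma enormD x y : enorm (x + y) <= enorm x + enorm y.
Proof.
rewrite enorm_le ?addr_ge0 ?enorm_ge0//.
have := dotv_le_enorm x y; rewrite !dotvE (dotvC y x) -!enorm_sqr; nra.
Qed.

Lemma dotv_self_le_enorm x y : dotv x x <= dotv y x -> enorm x <= enorm y.
Proof.
move=> h; have [->|/enorm_gt0 x0] := eqVneq x 0; first by rewrite enorm0 enorm_ge0.
by rewrite -(ler_pM2r x0) -expr2 enorm_sqr (le_trans h)// dotv_le_enorm.
Qed.

Lemma enorm_dist x y z : enorm (x - y) <= enorm (x - z) + enorm (y - z).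
Proof. by rewrite -(subrKA z x) (enormB y); exact: enormD. Qed.

Lemma enorm_coord x i : `|x 0 i| <= enorm x.
Proof.
rewrite -sqrtr_sqr ler_sqrt ?dotv_ge0// /dotv (bigD1 i)//= expr2 lerDl.
by apply: sumr_ge0 => j _; rewrite -expr2 sqr_ge0.
Qed.

(** Limits are taken coordinate by coordinate, so that no comparison of the sup-norm topology with
    the Euclidean norm is involved. *)
Lemma dotv_cvg (T : Type) (G : set_system T) (FG : Filter G)
    (f g : T -> 'rV[R]_d) x y :
  (forall i, (fun t => f t 0 i) @ G --> x 0 i) ->
  (forall i, (fun t => g t 0 i) @ G --> y 0 i) ->
  (fun t => dotv (f t) (g t)) @ G --> dotv x y.
Proof.
move=> fx gy; rewrite /dotv.
have h : forall i : 'I_d, true ->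
    (fun t => f t 0 i * g t 0 i) @ G --> x 0 i * y 0 i.
  by move=> i _; apply: cvgM.
have := @cvg_big R _ +%R 0 xpredT (@add_continuous R) _ G (index_enum _) _ _ FG h.
exact.
Qed.

(** The hypothesis is the parallelogram estimate for a minimising sequence whose [n]-th excess is
    below [n.+1%:R^-1]; it makes every coordinate Cauchy. *)
Lemma cauchy_coord_cvg (x_ : nat -> 'rV[R]_d) (c : R) :
  (forall m n, dotv (x_ m - x_ n) (x_ m - x_ n) <=
    c * (m.+1%:R^-1 + n.+1%:R^-1)) ->
  exists x : 'rV[R]_d, forall i, (fun n => x_ n 0 i) @ \oo --> x 0 i.
Proof.
move=> xc.
suff cv i : cvgn (fun n => x_ n 0 i).
  by exists (\row_i limn (fun n => x_ n 0 i)) => i; rewrite mxE; exact: cv.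
apply: cauchy_cvg; apply: cauchy_exP => e e0.
have [N cN] : exists N : nat, c * (2 / N.+1%:R) < e ^+ 2.
  have := near_infty_natSinv_lt (PosNum (divr_gt0 (exprn_gt0 2 e0)
    (ltr_wpDl (mulr_ge0 (ler0n R 2) (normr_ge0 c)) ltr01))).
  case=> N _ /(_ N (leqnn N)) /= h; exists N.
  have : c <= `|c| by exact: ler_norm.
  rewrite ltr_pdivlMr ?ltr_wpDl ?mulr_ge0// in h.
  have : 0 < N.+1%:R^-1 :> R by rewrite invr_gt0.
  move: h; set n := _^-1; nra.
exists (x_ N 0 i); exists N => // n /= Nn.
rewrite /ball /= /ball_ /=.
have -> : x_ N 0 i - x_ n 0 i = (x_ N - x_ n) 0 i by rewrite !mxE.
apply: le_lt_trans (enorm_coord _ _) _.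
rewrite -ltr_sqr ?nnegrE ?enorm_ge0 ?(ltW e0)// enorm_sqr.
have h := xc N n.
(* The case [m = n = N] of the hypothesis forces [0 <= c]. *)
have := xc N N; rewrite subrr dotv0l => h0.
have N0 : 0 < N.+1%:R^-1 :> R by rewrite invr_gt0.
have c0 : 0 <= c by move: h0; set q := _^-1 in N0 *; nra.
apply: le_lt_trans h _; apply: le_lt_trans cN; apply: ler_wpM2l => //.
have : n.+1%:R^-1 <= N.+1%:R^-1 :> R by rewrite lef_pV2 ?posrE// ler_nat.
by move: (N.+1%:R^-1) (n.+1%:R^-1) => p q; lra.
Qed.

End Euclidean.

(** * Scalar inequalities *)

Section Scalars.
Context {R : realType}.

(** If [p] were negative, [t = - p / (2 * q)], or [t = 1] when this exceeds 1, would make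
    [p + t * q] negative. This replaces the limit of [t] to 0 in first-order arguments. *)
Lemma ge0_of_first_order (p q : R) :
  (forall t, 0 < t -> t <= 1 -> 0 <= p + t * q) -> 0 <= p.
Proof.
move=> h; have [//|p0] := leP 0 p.
have q0 : 0 < q by have := h 1 ltr01 (lexx _); lra.
have pq : 0 < - p / (2 * q) by rewrite divr_gt0 ?mulr_gt0 ?oppr_gt0.
have [t1|t1] := leP (- p / (2 * q)) 1.
  have := h _ pq t1; have -> : - p / (2 * q) * q = - p / 2 by field; lra.
  lra.
have := h 1 ltr01 (lexx _); rewrite ltr_pdivlMr ?mulr_gt0// in t1; lra.
Qed.

(** Based on [a * r1 - b * r2 = (a - b) * r1 + b * (r1 - r2)]; [r1] and [r2] will be the gaps at two
    trial steps. *)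
Lemma product_lipschitz (a b r1 r2 D s t c : R) :
  a - b <= D -> 0 <= r1 -> 0 <= D -> r1 <= s -> r1 <= r2 + t * D ->
  0 <= b -> b <= c -> 0 <= t * D -> a * r1 - b * r2 <= (s + c * t) * D.
Proof.
move=> abD r10 D0 r1s rr b0 bc tD.
have h1 := ler_wpM2r r10 abD; have h2 := ler_wpM2l D0 r1s.
have h3 := ler_wpM2l b0 rr; have h4 := ler_wpM2r tD bc.
lra.
Qed.

(** The left side is the tangent at [m] of the convex function [x^-4]. With [t = x / m] the claim
    becomes [(5 - 4 * t) * t ^+ 4 <= 1], where the difference has a double root at [t = 1]. *)
Lemma inv_pow4_tangent (x m : R) : 0 < x -> 0 < m ->
  (5 - 4 * (x / m)) / m ^+ 4 <= (x ^+ 4)^-1.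
Proof.
move=> x0 m0; have t0 : 0 < x / m by rewrite divr_gt0.
have {2}-> : x = x / m * m by rewrite divfK// gt_eqF.
move: (x / m) t0 => t t0.
rewrite exprMn (invfM (t ^+ 4)) ler_pM2r ?invr_gt0 ?exprn_gt0// -[leRHS]mul1r.
rewrite ler_pdivlMr ?exprn_gt0// -subr_ge0.
have -> : 1 - (5 - 4 * t) * t ^+ 4 =
  (t - 1) ^+ 2 * (4 * t ^+ 3 + 3 * t ^+ 2 + 2 * t + 1) by ring.
rewrite mulr_ge0 ?sqr_ge0// !addr_ge0// ?mulr_ge0// ?exprn_ge0// ltW//.
Qed.

(* Hoelder's inequality for the increments of [sqrt A], which satisfy
   [sqrt (A + a) - sqrt A >= a / (2 sqrt (A + a))]; it is obtained by adding the
   tangents of [x^-4] at the mean increment [sqrt (A + a) / (k + 1)]. *)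
Lemma step_growth (k A a S : R) : 0 <= k -> 0 <= A -> 0 < a -> 0 <= S ->
  k ^+ 5 <= 16 * S * A ^+ 2 ->
  (k + 1) ^+ 5 <= 16 * (S + (A + a) ^+ 2 / a ^+ 4) * (A + a) ^+ 2.
Proof.
move=> k0 A0 a0 S0 kS; have A'0 : 0 < A + a by lra.
have a4 : 0 < a ^+ 4 by rewrite exprn_gt0.
move: k0; rewrite le_eqVlt => /predU1P[k0|k0].
  rewrite -k0 add0r expr1n.
  have h : 1 <= (A + a) ^+ 2 * (A + a) ^+ 2 / a ^+ 4.
    rewrite ler_pdivlMr// mul1r -exprD lerXn2r ?nnegrE; lra.
  have := mulr_ge0 S0 (sqr_ge0 (A + a)).
  move: h; move: ((A + a) ^+ 2) (a ^+ 4)^-1 => p q; nra.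
have {A0} A0 : 0 < A.
  rewrite lt_def A0 andbT; apply/eqP => A00; move: kS.
  by rewrite A00 expr0n mulr0 leNgt exprn_gt0.
pose B := Num.sqrt A; pose B' := Num.sqrt (A + a).
have B0 : 0 < B by rewrite sqrtr_gt0.
have B'0 : 0 < B' by rewrite sqrtr_gt0.
have BA : B ^+ 2 = A by rewrite sqr_sqrtr// ltW.
have BA' : B' ^+ 2 = A + a by rewrite sqr_sqrtr// ltW.
pose b := B' - B.
have b0 : 0 < b by rewrite subr_gt0 ltr_sqrt// ltrDl.
have ab : a <= 2 * B' * b by rewrite /b; nra.
pose m := B' / (k + 1); have k1 : 0 < k + 1 by lra.
have m0 : 0 < m by rewrite divr_gt0.
have h1 : (b ^+ 4)^-1 <= 16 * ((A + a) ^+ 2 / a ^+ 4).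
  rewrite mulrA ler_pdivlMr// mulrC ler_pdivrMr ?exprn_gt0// -BA'.
  have -> : 16 * (B' ^+ 2) ^+ 2 * b ^+ 4 = (2 * B' * b) ^+ 4 by ring.
  by rewrite lerXn2r ?nnegrE// ?(ltW a0)// (le_trans (ltW a0)).
(* The first [k] increments of [sqrt A] enter only through their mean [B / k]. *)
have h2 : k * ((B / k) ^+ 4)^-1 <= 16 * S.
  have -> : k * ((B / k) ^+ 4)^-1 = k ^+ 5 / A ^+ 2.
    by rewrite -BA; field; rewrite !gt_eqF.
  by rewrite ler_pdivrMr ?exprn_gt0.
have h3 := inv_pow4_tangent b0 m0.
have h4 := inv_pow4_tangent (divr_gt0 B0 k0) m0.
(* Since [k * (B / k) + b = B' = (k + 1) * m], the weighted tangents add up to exactly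
   [(k + 1) / m ^+ 4]. *)
have h5 : (k + 1) / m ^+ 4 <= 16 * (S + (A + a) ^+ 2 / a ^+ 4).
  rewrite mulrDr; apply: le_trans (lerD h2 h1).
  apply: le_trans (lerD (ler_wpM2l (ltW k0) h4) h3).
  rewrite le_eqVlt; apply/orP; left; apply/eqP; rewrite /m /b.
  by field; rewrite !gt_eqF.
apply: le_trans (ler_wpM2r (sqr_ge0 _) h5).
rewrite le_eqVlt; apply/orP; left; apply/eqP; rewrite /m -BA'.
by field; rewrite !gt_eqF.
Qed.

Lemma lt_powR_two_fifths (k Y : R) : 0 <= k -> 0 < Y ->
  k ^+ 5 < Y ^+ 2 -> k < Y `^ (2 / 5).
Proof.
move=> k0 Y0; rewrite !ltNge; apply: contra => h.
have -> : Y ^+ 2 = (Y `^ (2 / 5)) ^+ 5.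
  by rewrite -(powR_mulrn 5) ?powR_ge0// -powRrM divfK// powR_mulrn ?ltW.
by rewrite lerXn2r ?nnegrE ?powR_ge0.
Qed.

End Scalars.

(** * Maximally monotone operators *)

Section MaximalMonotone.
Context {R : realType} {d : nat}.
Implicit Types (H : 'rV[R]_d -> set 'rV[R]_d).

(** A pair monotonically related to the graph can be adjoined to it without losing monotonicity, so
    maximality puts it on the graph already. *)
Lemma maximally_monotoneP H :
  maximally_monotone H <->
  monotone_op H /\
  forall x u, (forall y v, H y v -> 0 <= dotv (u - v) (x - y)) -> H x u.
Proof.
split=> -[Hm Hx]; split=> //.
  move=> x u xu.
  apply: (Hx (fun y => [set v | H y v \/ y = x /\ v = u])) => [|y v|]; last 2 first.
  - by left.
  - by right.
  move=> y y' v v' /= [yv|[-> ->]] [yv'|[-> ->]].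
  - exact: Hm.
  - by have := xu _ _ yv; rewrite !dotvE; lra.
  - exact: xu.
  - by rewrite !subrr dotv0l.
by move=> G Gm HG x u Gxu; apply: Hx => y v /HG; exact: Gm.
Qed.

Lemma maximally_monotone_nonempty H :
  maximally_monotone H -> exists x u, H x u.
Proof.
move=> /maximally_monotoneP[_ Hx]; apply: contrapT => H0.
apply: (H0); exists 0, 0; apply: Hx => y v yv.
by case: H0; exists y, v.
Qed.

(* Minty's theorem.  [K] is the epigraph of the Fitzpatrick function of [H]:
   it is convex, and maximality says [dotv y v <= s] on [K].  The strongly convex
   function [s + (|y|^2 + |v|^2) / 2] has a minimiser on [K], and its first-order
   condition makes [(- v, - y)] monotonically related to the graph of [H]. *)
Lemma minty H : maximally_monotone H -> exists y, H y (- y).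
Proof.
move=> Hmax; have [x0 [u0 xu0]] := maximally_monotone_nonempty Hmax.
have [Hm Hx] := (maximally_monotoneP H).1 Hmax.
pose K (y v : 'rV[R]_d) (s : R) := forall y' v', H y' v' ->
  dotv y' v + dotv y v' - dotv y' v' <= s.
have KH y v : H y v -> K y v (dotv y v).
  move=> yv y' v' yv'; have := Hm _ _ _ _ yv yv'.
  by rewrite !dotvE (dotvC v) (dotvC v y') (dotvC v' y) (dotvC v'); lra.
(* If [s < dotv y v], then [(y, v)] is monotonically related to the graph, hence lies on it, and
   testing [K] at [(y, v)] itself is a contradiction. *)
have K_ge y v s : K y v s -> dotv y v <= s.
  move=> Kyvs; have [//|sy] := leP (dotv y v) s.
  have yv : H y v.
    apply: Hx => y' v' /Kyvs.
    by rewrite !dotvE (dotvC v) (dotvC v y') (dotvC v' y) (dotvC v'); lra.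
  have := Kyvs _ _ yv; lra.
have K_conv y v s y' v' s' (t : R) : 0 < t -> t <= 1 -> K y v s -> K y' v' s' ->
    K (y + t *: (y' - y)) (v + t *: (v' - v)) (s + t * (s' - s)).
  move=> t0 t1 h h' p q pq; have := h _ _ pq; have := h' _ _ pq.
  rewrite !dotvE; nra.
pose val (y v : 'rV[R]_d) (s : R) : R := s + (dotv y y + dotv v v) / 2.
pose W := [set val w.1.1 w.1.2 w.2 | w in [set w : 'rV[R]_d * 'rV[R]_d * R | K w.1.1 w.1.2 w.2]].
have hW : has_inf W.
  split; first by exists (val x0 u0 (dotv x0 u0)), (x0, u0, dotv x0 u0) => //=; exact: KH.
  exists 0 => _ [[[y v] s] /= /K_ge ys <-].
  have := dotv_ge0 (y + v); rewrite !dotvE (dotvC v y) /val; lra.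
pose c := inf W.
have c_le y v s : K y v s -> c <= val y v s.
  by move=> h; apply: ge_inf; [exact: hW.2 | exists (y, v, s)].
have /choice[w_ w_P] n : exists w : 'rV[R]_d * 'rV[R]_d * R,
    K w.1.1 w.1.2 w.2 /\ val w.1.1 w.1.2 w.2 < c + n.+1%:R^-1.
  have [|_ [w Kw <-] lw] := @inf_adherent _ W n.+1%:R^-1 _ hW.
    by rewrite invr_gt0.
  by exists w.
pose y_ n := (w_ n).1.1; pose v_ n := (w_ n).1.2; pose s_ n := (w_ n).2.
have par m n : dotv (y_ m - y_ n) (y_ m - y_ n) + dotv (v_ m - v_ n) (v_ m - v_ n)
    <= 4 * (m.+1%:R^-1 + n.+1%:R^-1).
  have [Km lm] := w_P m; have [Kn ln] := w_P n.
  have h2 : 2^-1 <= 1 :> R by lra.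
  (* Strong convexity: the midpoint of two near-minimisers still has value at least [c], which
     forces them close together. *)
  have := c_le _ _ _ (K_conv _ _ _ _ _ _ 2^-1 _ h2 Km Kn).
  rewrite invr_gt0 ltr0n => /(_ isT).
  move: lm ln; rewrite /val -/(y_ m) -/(y_ n) -/(v_ m) -/(v_ n) -/(s_ m) -/(s_ n).
  rewrite !dotvE (dotvC (y_ n) (y_ m)) (dotvC (v_ n) (v_ m)).
  move: (m.+1%:R^-1) (n.+1%:R^-1) => p q; lra.
have [y ylim] : exists y : 'rV[R]_d, forall i, (fun n => y_ n 0 i) @ \oo --> y 0 i.
  apply: (@cauchy_coord_cvg _ _ _ 4) => m n; apply: le_trans (par m n).
  by rewrite lerDl dotv_ge0.
have [v vlim] : exists v : 'rV[R]_d, forall i, (fun n => v_ n 0 i) @ \oo --> v 0 i.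
  apply: (@cauchy_coord_cvg _ _ _ 4) => m n; apply: le_trans (par m n).
  by rewrite lerDr dotv_ge0.
(* This choice gives [val y v s = c], so the infimum is attained once [K y v s] is known. *)
pose s := c - (dotv y y + dotv v v) / 2.
have Kyvs : K y v s.
  move=> y' v' yv'.
  have l1 : (fun n => dotv y' (v_ n) + dotv (y_ n) v' - dotv y' v'
      + (dotv (y_ n) (y_ n) + dotv (v_ n) (v_ n)) / 2) @ \oo -->
      dotv y' v + dotv y v' - dotv y' v' + (dotv y y + dotv v v) / 2.
    apply: cvgD; last by apply: cvgM; [apply: cvgD; exact: dotv_cvg|exact: cvg_cst].
    apply: cvgB; last exact: cvg_cst.
    by apply: cvgD; apply: dotv_cvg => // i; exact: cvg_cst.
  have l2 : (fun n => c + n.+1%:R^-1) @ \oo --> c + 0.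
    by apply: cvgD; [exact: cvg_cst | exact: cvg_harmonic].
  have : dotv y' v + dotv y v' - dotv y' v' + (dotv y y + dotv v v) / 2 <= c + 0.
    apply: (ler_cvg_to l1 l2); apply: nearW => n.
    have [/(_ _ _ yv')] := w_P n; rewrite /val -/(y_ n) -/(v_ n) -/(s_ n).
    move: (n.+1%:R^-1) => p; lra.
  rewrite /s; lra.
have first y' v' : H y' v' ->
    0 <= dotv y' v' - s + dotv y (y' - y) + dotv v (v' - v).
  move=> yv'.
  apply: (@ge0_of_first_order _ _
    ((dotv (y' - y) (y' - y) + dotv (v' - v) (v' - v)) / 2)) => t t0 t1.
  rewrite -(pmulr_rge0 _ t0).
  have := c_le _ _ _ (K_conv _ _ _ _ _ _ t t0 t1 Kyvs (KH _ _ yv')).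
  rewrite /val /s !dotvE (dotvC y' y) (dotvC v' v); nra.
(* Together with [dotv y v <= s], the first-order condition bounds the pairing with any graph point
   below by [dotv (y + v) (y + v)]. *)
have Hvy : H (- v) (- y).
  apply: Hx => y' v' yv'; have := first _ _ yv'; have := K_ge _ _ _ Kyvs.
  have := dotv_ge0 (y + v).
  rewrite !dotvE (dotvC v y) (dotvC v' v) (dotvC v' y'); lra.
(* The first-order condition at the graph point just found gives [dotv (y + v) (y + v) <= 0]. *)
have vy : y + v = 0.
  apply: dotv_le0; have := first _ _ Hvy; have := K_ge _ _ _ Kyvs.
  rewrite !dotvE (dotvC v y); lra.
by exists (- v); rewrite opprK -[X in H _ X](addr0_eq vy).
Qed.

(** The operator is [l H - c]; Minty's theorem applied to it solves the resolvent equation of [l H]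
    at [c]. *)
Lemma maximally_monotone_affine H (l : R) c : 0 < l -> maximally_monotone H ->
  maximally_monotone (fun x => [set w | H x (l^-1 *: (w + c))]).
Proof.
move=> l0 /maximally_monotoneP[Hm Hx]; apply/maximally_monotoneP; split.
  move=> x y u v /= xu yv; have := Hm _ _ _ _ xu yv.
  rewrite -scalerBr dotvZl pmulr_rge0 ?invr_gt0//.
  by rewrite opprD addrACA subrr addr0.
move=> x u xu; apply: Hx => y v yv.
have := xu y (l *: v - c); rewrite /= subrK scalerA mulVf ?gt_eqF// scale1r.
move=> /(_ yv) h; rewrite -(pmulr_rge0 _ l0) -dotvZl scalerBr scalerA mulfV ?gt_eqF//.
by rewrite scale1r -addrA -(opprB (_ *: v)).
Qed.

Lemma resolvent_surj H (l : R) c : 0 < l -> maximally_monotone H ->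
  exists x u, H x u /\ x + l *: u = c.
Proof.
move=> l0 /(maximally_monotone_affine c l0) /minty[x /= Hxu].
exists x, (l^-1 *: (- x + c)); split=> //.
by rewrite scalerA mulfV ?gt_eqF// scale1r addrA subrr add0r.
Qed.

(** For [(x, w)] related to the graph of [H + M], the resolvent of [H] with step [(1 + |C|)^-1]
    supplies a graph point [(y, u)] at which relatedness reads [(1 + |C|) |x - y|^2 <= dotv (M (x -
    y)) (x - y)]. The bound by [C] then forces [x = y]. *)
Lemma maximally_monotone_add_linear H (M : 'rV[R]_d -> 'rV[R]_d) (C : R) :
  {morph M : x y / x - y} -> (forall x, 0 <= dotv (M x) x) ->
  (forall x, dotv (M x) x <= C * dotv x x) ->
  maximally_monotone H -> maximally_monotone (fun x => [set w | H x (w - M x)]).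
Proof.
move=> MB M0 MC Hmax; have [Hm Hx] := (maximally_monotoneP H).1 Hmax.
apply/maximally_monotoneP; split.
  move=> x y u v /= xu yv; have := Hm _ _ _ _ xu yv; have := M0 (x - y).
  by rewrite MB !dotvE; lra.
move=> x w xw /=.
have l0 : 0 < (1 + `|C|)^-1 by rewrite invr_gt0 ltr_pwDl.
have [y [u [yu e]]] := resolvent_surj (x + (1 + `|C|)^-1 *: (w - M x)) l0 Hmax.
have ul : u - (w - M x) = (1 + `|C|) *: (x - y).
  apply: (scalerI (lt0r_neq0 l0)).
  rewrite [RHS]scalerA mulVf ?scale1r; last by rewrite gt_eqF ?ltr_pwDl.
  by apply/eqP; rewrite scalerBr subr_eq addrAC -e addrAC subrr add0r.
have xy : x - y = 0.
  apply: dotv_le0; have := xw y (u + M y); rewrite /= addrK => /(_ yu).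
  have -> : w - (u + M y) = M (x - y) - (1 + `|C|) *: (x - y).
    by rewrite -ul MB; apply/rowP => i; rewrite !mxE; ring.
  rewrite dotvDl dotvNl dotvZl.
  have := MC (x - y); have := ler_norm C; have := dotv_ge0 (x - y).
  move: (dotv (x - y) _) (dotv (M _) _) `|C| => p q r; nra.
have -> : w - M x = u by apply/esym/eqP; rewrite -subr_eq0 ul xy scaler0.
by move/eqP: xy; rewrite subr_eq0 => /eqP ->.
Qed.

End MaximalMonotone.

(** * Smoothness and the trial subproblem *)

Section LinearMaps.
Context {R : realType} {d : nat}.

(** Only homogeneity is asked of [A], because it will be the difference of two differentials, given
    as a bare function. *)
Lemma enorm_le_opnorm (A : 'rV[R]_d -> 'rV[R]_d) (c : R) x :
  (forall a y, A (a *: y) = a *: A y) -> (opnorm A <= c%:E)%E ->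
  enorm (A x) <= c * enorm x.
Proof.
move=> AZ Ac; have [->|/enorm_gt0 x0] := eqVneq x 0.
  by rewrite -(scale0r 0) AZ !scale0r enorm0 mulr0.
rewrite -ler_pdivrMr// mulrC -(gtr0_norm x0) -normfV -enormZ -AZ -lee_fin.
apply: le_trans Ac; apply: ereal_sup_ubound; exists ((enorm x)^-1 *: x) => //=.
by rewrite enormZ ger0_norm ?invr_ge0 ?enorm_ge0// mulVf// gt_eqF.
Qed.

Lemma linear_enorm_bounded (A : {linear 'rV[R]_d -> 'rV[R]_d}) :
  exists C, forall x, enorm (A x) <= C * enorm x.
Proof.
exists (\sum_(i < d) enorm (A 'e_i)) => x.
rewrite {1}(row_sum_delta x) linear_sum mulr_suml.
apply: (@le_trans _ _ (\sum_(i < d) enorm (A (x 0 i *: 'e_i)))).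
  elim/big_ind2: _ => [|y1 y2 z1 z2 h1 h2|//]; first by rewrite enorm0.
  by apply: le_trans (enormD _ _) _; exact: lerD.
apply: ler_sum => i _; rewrite linearZ enormZ mulrC.
by apply: ler_wpM2l; [exact: enorm_ge0 | exact: enorm_coord].
Qed.

End LinearMaps.

(** * First-order estimates for [F] *)

Section Smooth.
Context {R : realType} {d : nat}.
Context (F : 'rV[R]_d -> 'rV[R]_d) (L2 : R) (L2_gt0 : 0 < L2).
Hypothesis Fmono : monotone_map F.
Hypothesis Fdiff : forall z : 'rV[R]_d, differentiable F z.
Hypothesis Flip : forall z z' : 'rV[R]_d,
  (opnorm (fun x => 'd F z x - 'd F z' x)%R <= (L2 * enorm (z - z'))%:E)%E.

Lemma diff_lipschitz z z' x :
  enorm ('d F z x - 'd F z' x) <= L2 * enorm (z - z') * enorm x.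
Proof.
apply: (enorm_le_opnorm (A := fun x => 'd F z x - 'd F z' x)) (Flip z z').
by move=> a y; rewrite scalerBr; congr (_ - _); exact: linearZZ.
Qed.

(** Pairing with a fixed [u] reduces Taylor's estimate for the vector-valued [F] to a scalar
    derivative along a line. *)
Lemma is_derive_dotv_line u w h t :
  is_derive t (1 : R) (fun s => dotv u (F (w + s *: h)))
    (dotv u ('d F (w + t *: h) h)).
Proof.
have lim : (fun s : R => s^-1 *: (dotv u (F (w + (s *: 1 + t) *: h)) -
    dotv u (F (w + t *: h)))) @ 0^' --> dotv u ('d F (w + t *: h) h).
  have dF : (fun s => s^-1 *: (F (s *: h + (w + t *: h)) - F (w + t *: h)))
      @ 0^' --> 'd F (w + t *: h) h.
    by rewrite -deriveE//; exact: (diff_derivable (v := h) (Fdiff _)).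
  have -> : (fun s : R => s^-1 *: (dotv u (F (w + (s *: 1 + t) *: h)) -
      dotv u (F (w + t *: h)))) =
    (fun s => dotv u (s^-1 *: (F (s *: h + (w + t *: h)) - F (w + t *: h)))).
    apply/funext => s; rewrite dotvZr dotvDr dotvNr; congr (_ * (dotv u (F _) - _)).
    by rewrite scalerDl -[s *: 1]/(s * 1) mulr1 addrCA.
  apply: dotv_cvg => i; first exact: cvg_cst.
  apply: (@cvg_comp _ _ _ _ (fun M : 'rV[R]_d => M 0 i) _ _ _ dF).
  exact: coord_continuous.
by split; [apply/cvg_ex; exists (dotv u ('d F (w + t *: h) h)) | exact: cvg_lim].
Qed.

(** The error [u] is paired with itself: [f] has nonpositive derivative on the unit interval, and
    [f 1 <= f 0] says [|u|^2 <= L2 / 2 * |h|^2 * |u|]. *)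
Lemma taylor_bound x w :
  enorm (F x - affine_model F w x) <= L2 / 2 * enorm (x - w) ^+ 2.
Proof.
set u := F x - _; pose h := x - w.
pose f s := dotv u (F (w + s *: h)) - s * dotv u ('d F w h)
  - s ^+ 2 * (L2 / 2 * enorm h ^+ 2 * enorm u).
pose f' s := dotv u ('d F (w + s *: h) h) - dotv u ('d F w h)
  - s * (L2 * enorm h ^+ 2 * enorm u).
have df s : is_derive s (1 : R) f (f' s).
  have lin c : is_derive s (1 : R) (fun s => s * c) c.
    by apply: is_derive_eq; rewrite /GRing.scale /=; ring.
  have quad c : is_derive s (1 : R) (fun s => s ^+ 2 * (2^-1 * c)) (s * c).
    by apply: is_derive_eq; rewrite /GRing.scale /=; field.
  have -> : f = (fun s => dotv u (F (w + s *: h))) - (fun s => s * dotv u ('d F w h))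
      - (fun s => s ^+ 2 * (2^-1 * (L2 * enorm h ^+ 2 * enorm u))).
    by apply/funext => r; rewrite /f !fctE; congr (_ - _ * _); rewrite !mulrA (mulrC L2).
  exact: is_deriveB (is_deriveB (is_derive_dotv_line u w h s) (lin _)) (quad _).
have : f 1 <= f 0.
  apply: (@ler0_derive1_nincr _ f 0 1) => //.
  - move=> s; rewrite in_itv/= derive1E derive_val => /andP[s0 _].
    rewrite /f' subr_le0 -dotvNr -dotvDr; apply: le_trans (dotv_le_enorm _ _) _.
    apply: le_trans (ler_wpM2l (enorm_ge0 u) (diff_lipschitz _ _ _)) _.
    rewrite addrAC subrr add0r enormZ gtr0_norm// le_eqVlt.
    by apply/orP; left; apply/eqP; ring.
  - by apply: continuous_subspaceT => s; apply/differentiable_continuous/derivable1_diffP.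
have wh : w + h = x by rewrite /h addrC subrK.
rewrite /f scale0r scale1r addr0 wh.
rewrite expr1n expr0n /= !mul0r !mul1r !subr0 => fle.
have : enorm u * enorm u <= L2 / 2 * enorm h ^+ 2 * enorm u.
  rewrite -expr2 enorm_sqr {2}/u /affine_model dotvDr dotvNr dotvDr -/h; lra.
have [->|/enorm_gt0 u0] := eqVneq u 0; last by rewrite ler_pM2r.
by rewrite enorm0 => _; rewrite mulr_ge0 ?sqr_ge0// divr_ge0 ?ltW.
Qed.

(** Monotonicity of [F] between [w + t *: h] and [w], divided by [t^2], is the claim up to a Taylor
    error of order [t]. *)
Lemma diff_monotone w h : 0 <= dotv ('d F w h) h.
Proof.
apply: (@ge0_of_first_order _ _ (L2 / 2 * enorm h ^+ 2 * enorm h)) => t t0 t1.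
rewrite -(pmulr_rge0 _ (mulr_gt0 t0 t0)).
have := Fmono (w + t *: h) w; rewrite addrAC subrr add0r.
have := taylor_bound (w + t *: h) w.
rewrite /affine_model addrAC subrr add0r enormZ linearZ gtr0_norm// => le1.
have := dotv_le_enorm (F (w + t *: h) - (F w + t *: 'd F w h)) h.
have := ler_wpM2r (enorm_ge0 h) le1.
rewrite !dotvE.
move: (enorm (_ - _)) (dotv (F (w + _)) h) (dotv (F w) h) (dotv ('d _ _ _) h).
by move=> p q r s; nra.
Qed.

(** * Solvability of the trial subproblem *)

Section Trial.
Context (H : 'rV[R]_d -> set 'rV[R]_d) (Hmax : maximally_monotone H).

Lemma trial_inclusionP z0 z v (A a : R) x : 0 < a ->
  trial_inclusion F H z0 z v A a x <-> H x (trial_dual F z0 z v A a x).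
Proof.
move=> a0; rewrite /trial_inclusion /trial_dual /=; set P := affine_model _ _ _.
set c := anchored _ _ _ _; split.
  move=> [u xu /eqP]; rewrite subr_eq0 => /eqP <-.
  rewrite addrK -scalerDr.
  by rewrite scalerA mulVf ?gt_eqF// scale1r (addrC P) addrK.
move=> xu; exists (a^-1 *: (c - x) - P) => //.
rewrite scalerBr scalerA mulfV ?gt_eqF// scale1r.
by apply/rowP => i; rewrite !mxE; ring.
Qed.

(** The inclusion is a resolvent equation for [H + 'd F w], which is maximally monotone because the
    differential is monotone and bounded. *)
Lemma trial_point_exists z0 z v (A a : R) : 0 < a ->
  exists x, trial_point F H z0 z v A a x.
Proof.
move=> a0; set c := anchored z0 A a z; set w := half_point F z0 z v A a.
have [C hC] := linear_enorm_bounded ('d F w).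
have Hmax' : maximally_monotone (fun x => [set y | H x (y - 'd F w x)]).
  apply: (@maximally_monotone_add_linear _ _ H _ C) => //.
  - by move=> x y; rewrite linearB.
  - exact: diff_monotone.
  - move=> x; apply: le_trans (dotv_le_enorm _ _) _.
    by rewrite -enorm_sqr expr2 mulrA ler_wpM2r ?enorm_ge0.
(* The centre absorbs the constant part [F w - 'd F w w] of the affine model. *)
have [x [u [/= xu e]]] := resolvent_surj (c - a *: (F w - 'd F w w)) a0 Hmax'.
exists x; split.
  exists (u - 'd F w x) => //=; rewrite /affine_model -/w -/c linearB.
  move/rowP: e => e; apply/rowP => i; have := e i; rewrite !mxE.
  move: (c 0 i) (x 0 i) (u 0 i) => ci xi ui; lra.
move=> y [uy yuy /rowP ey]; apply/esym/eqP; rewrite -subr_eq0; apply/eqP/dotv_le0.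
have := Hmax.1 _ _ _ _ yuy xu; have := diff_monotone w (y - x); rewrite -(pmulr_rge0 _ a0).
move=> dF; rewrite -(pmulr_rge0 _ a0).
move=> mono.
(* Subtracting the equations of two solutions expresses [|y - x|^2] as minus two terms that
   monotonicity makes nonnegative. *)
suff -> : dotv (y - x) (y - x) = - (a * dotv ('d F w (y - x)) (y - x))
    - a * dotv (uy - (u - 'd F w x)) (y - x) by lra.
rewrite -!dotvZl -!dotvNl -dotvDl; congr (dotv _ (y - x)).
move/rowP: e => e; rewrite linearB; apply/rowP => i.
have := e i; have := ey i; rewrite /affine_model -/w -/c linearB !mxE.
move: (c 0 i) (x 0 i) (u 0 i) => ci xi ui; lra.
Qed.

End Trial.
End Smooth.

(** * One accepted step *)

Section Step.
Context {R : realType} {d : nat}.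
Context (F : 'rV[R]_d -> 'rV[R]_d) (L2 : R) (L2_gt0 : 0 < L2).
Hypothesis Fmono : monotone_map F.
Hypothesis Fdiff : forall z : 'rV[R]_d, differentiable F z.
Hypothesis Flip : forall z z' : 'rV[R]_d,
  (opnorm (fun x => 'd F z x - 'd F z' x)%R <= (L2 * enorm (z - z'))%:E)%E.
Context (H : 'rV[R]_d -> set 'rV[R]_d) (Hmono : monotone_op H).

Definition potential (z0 z v : 'rV[R]_d) (A : R) : R :=
  A ^+ 2 * dotv (F z + v) (F z + v) / 2 + A * dotv (F z + v) (z - z0).

Section OneStep.
Context (z0 z v : 'rV[R]_d) (A a : R) (x : 'rV[R]_d).
Hypotheses (A0 : 0 <= A) (a0 : 0 < a).
Let w := half_point F z0 z v A a.
Let p := trial_dual F z0 z v A a x.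
Let e := affine_model F w x - F x.
Let g := F z + v.
Let g' := F x + p.

Let A'0 : 0 < A + a. Proof. by rewrite ltr_wpDl. Qed.

(** From [c = anchored z0 A a z] both points are explicit: [x = c - a (g' + e)] and
    [w = c - (a A / (A + a)) g]. *)
Lemma trial_dual_half :
  (A + a) *: (x - w) = a *: (A *: g - (A + a) *: (g' + e)).
Proof.
have A'n : A + a != 0 by rewrite gt_eqF.
have an : a != 0 by rewrite gt_eqF.
rewrite /g' /e /p /trial_dual -/w; move: (affine_model _ _ _) => P.
rewrite /w /half_point /anchored -/g; apply/rowP => i; rewrite !mxE.
by field; rewrite A'n an.
Qed.

Lemma trial_dual_anchor :
  (A + a) *: (x - z0) = A *: (z - z0) - (a * (A + a)) *: (g' + e).
Proof.
have A'n : A + a != 0 by rewrite gt_eqF.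
have an : a != 0 by rewrite gt_eqF.
rewrite /g' /e /p /trial_dual -/w; move: (affine_model _ _ _) => P.
rewrite /anchored; apply/rowP => i; rewrite !mxE.
by field; rewrite A'n an.
Qed.

Lemma model_error : enorm e <= L2 / 2 * enorm (x - w) ^+ 2.
Proof. by rewrite /e enormB; exact: taylor_bound. Qed.

(** Solving [trial_dual_half] for [g'] leaves the errors [e] and [(x - w) / a]; with
    [r <= sqrt 2 / (L2 a)] they are at most [1 / (L2 a^2)] and [sqrt 2 / (L2 a^2)]. *)
Lemma residual_bound : merit F L2 z0 z v A a x <= Num.sqrt 2 ->
  enorm g' <= A / a * enorm g + (1 + Num.sqrt 2) / (L2 * a ^+ 2).
Proof.
rewrite /merit -/w => mx.
set r := enorm (x - w); have r0 : 0 <= r := enorm_ge0 _.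
have rle : r <= Num.sqrt 2 / (L2 * a) by rewrite ler_pdivlMr ?mulr_gt0// mulrC.
have er : enorm e <= (L2 * a ^+ 2)^-1.
  apply: le_trans model_error _; rewrite -/r.
  apply: (@le_trans _ _ (L2 / 2 * (Num.sqrt 2 / (L2 * a)) ^+ 2)).
    by rewrite ler_wpM2l ?divr_ge0 ?(ltW L2_gt0)// lerXn2r ?nnegrE// (le_trans r0).
  rewrite exprMn sqr_sqrtr// le_eqVlt; apply/orP; left; apply/eqP.
  by field; rewrite !gt_eqF.
have -> : g' = (A / (A + a)) *: g - e - a^-1 *: (x - w).
  apply: (scalerI (lt0r_neq0 (mulr_gt0 a0 A'0))).
  have /rowP h := trial_dual_half; clearbody w e g g'.
  apply/rowP => i; have := h i; rewrite !mxE.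
  move: (g 0 i) (e 0 i) (g' 0 i) (w 0 i) (x 0 i) => gi ei g'i wi xi hi.
  transitivity (a * (A + a) * (A / (A + a)) * gi - a * (A + a) * ei
     - (A + a) * (xi - wi)).
    rewrite hi; field; by rewrite gt_eqF.
  by field; rewrite !gt_eqF.
apply: le_trans (enormD _ _) _; rewrite enormN enormZ -/r.
rewrite (gtr0_norm (_ : 0 < a^-1)) ?invr_gt0//.
have := enormD ((A / (A + a)) *: g) (- e); rewrite enormN enormZ.
rewrite (ger0_norm (divr_ge0 A0 (ltW A'0))) => h.
have h1 : A / (A + a) * enorm g <= A / a * enorm g.
  by rewrite ler_wpM2r ?enorm_ge0// ler_wpM2l// lef_pV2 ?posrE// lerDr.
have h2 : a^-1 * r <= Num.sqrt 2 / (L2 * a ^+ 2).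
  have -> : Num.sqrt 2 / (L2 * a ^+ 2) = a^-1 * (Num.sqrt 2 / (L2 * a)).
    by field; rewrite !gt_eqF.
  by rewrite ler_wpM2l// invr_ge0 ltW.
rewrite mulrDl mul1r; lra.
Qed.

(** Monotonicity bounds the change of potential by [- (|q|^2 - (A + a)^2 |e|^2) / 2]. The upper
    merit bound makes the error term at most [|q|^2 / 2], and the lower one gives
    [|q|^2 >= (A + a)^2 / (L2^2 a^4)]. *)
Lemma potential_decrease : H z v -> H x p ->
  1 <= merit F L2 z0 z v A a x <= Num.sqrt 2 ->
  potential z0 x p (A + a) <=
    potential z0 z v A - (A + a) ^+ 2 / (4 * L2 ^+ 2 * a ^+ 4).
Proof.
move=> zv xp /andP[]; rewrite /merit -/w /potential -/g -/g'.
set r := enorm (x - w); have r0 : 0 <= r := enorm_ge0 _ => m1 m2.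
have mono : 0 <= dotv (g' - g) ((x - z0) - (z - z0)).
  have := Hmono xp zv; have := Fmono x z; rewrite !dotvE; lra.
have half := trial_dual_half; have me := model_error.
have anch := trial_dual_anchor; clearbody w e g g'.
pose q := A *: g - (A + a) *: (g' + e).
have qr : (A + a) * r = a * enorm q.
  by have := congr1 (@enorm R d) half; rewrite !enormZ !gtr0_norm.
have qE : enorm q = (A + a) * r / a by rewrite qr mulrAC mulfV ?mul1r// gt_eqF.
have er : (A + a) ^+ 2 * dotv e e <= enorm q ^+ 2 / 2.
  have h : (A + a) * enorm e <= Num.sqrt 2 / 2 * enorm q.
    apply: (@le_trans _ _ ((A + a) * (L2 / 2 * r ^+ 2))).
      by rewrite ler_wpM2l ?(ltW A'0)//; exact: me.
    have -> : (A + a) * (L2 / 2 * r ^+ 2) = L2 * a * r * ((A + a) * r / (2 * a)).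
      by field; rewrite gt_eqF.
    have -> : Num.sqrt 2 / 2 * enorm q = Num.sqrt 2 * ((A + a) * r / (2 * a)).
      by rewrite qE; field; rewrite gt_eqF.
    by rewrite ler_wpM2r// divr_ge0 ?mulr_ge0 ?(ltW A'0) ?(ltW a0).
  rewrite -enorm_sqr -exprMn.
  apply: (@le_trans _ _ ((Num.sqrt 2 / 2 * enorm q) ^+ 2)).
    by rewrite lerXn2r ?nnegrE ?mulr_ge0 ?enorm_ge0 ?(ltW A'0) ?invr_ge0 ?sqrtr_ge0.
  by rewrite !exprMn sqr_sqrtr//; lra.
have q_ge : (A + a) ^+ 2 / (L2 ^+ 2 * a ^+ 4) <= enorm q ^+ 2.
  have -> : enorm q ^+ 2 = (A + a) ^+ 2 / (L2 ^+ 2 * a ^+ 4) * (L2 * a * r) ^+ 2.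
    by rewrite qE; field; rewrite !gt_eqF.
  rewrite ler_peMr ?divr_ge0 ?mulr_ge0 ?exprn_ge0 ?(ltW A'0) ?(ltW L2_gt0) ?(ltW a0)//.
  by rewrite exprn_ege1.
have anchor u : (A + a) * dotv u (x - z0) =
    A * dotv u (z - z0) - a * (A + a) * (dotv u g' + dotv u e).
  have := congr1 (dotv u) anch.
  by rewrite dotvZr (dotvDr (_ *: _) (- _)) dotvNr !dotvZr (dotvDr g' e).
(* After multiplication by [a], this is [anchor g'] with weight [A + a], [anchor g] with weight [A],
   and [mono] with weight [A (A + a)]. *)
have telescope : (A + a) * dotv g' (x - z0) - A * dotv g (z - z0) <=
    - ((A + a) ^+ 2 * (dotv g' g' + dotv g' e)) + A * (A + a) * (dotv g g' + dotv g e).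
  rewrite -(ler_pM2l a0) -subr_ge0.
  have := mulr_ge0 A0 (mulr_ge0 (ltW A'0) mono).
  have := anchor g; have := anchor g'; rewrite !dotvE.
  move: (dotv g' (x - z0)) (dotv g (x - z0)) (dotv g' (z - z0)) (dotv g (z - z0)).
  move: (dotv g' g') (dotv g' e) (dotv g g') (dotv g e).
  move=> b1 b2 b3 b4 c1 c2 c3 c4 /(congr1 ( *%R (A + a))) e1 /(congr1 ( *%R A)) e2.
  lra.
have qq : enorm q ^+ 2 = A ^+ 2 * dotv g g + (A + a) ^+ 2 * (dotv g' g' +
   2 * dotv g' e + dotv e e) - 2 * A * (A + a) * (dotv g g' + dotv g e).
  by rewrite enorm_sqr !dotvE (dotvC g' g) (dotvC e g) (dotvC e g'); ring.
have -> : (A + a) ^+ 2 / (4 * L2 ^+ 2 * a ^+ 4) =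
    (A + a) ^+ 2 / (L2 ^+ 2 * a ^+ 4) / 4 by field; rewrite !gt_eqF.
move: q_ge er telescope; rewrite qq.
move: (dotv g' g') (dotv g' e) (dotv g g') (dotv g e) (_ / (L2 ^+ 2 * _)).
move: (dotv g g) (dotv e e) (dotv g' (x - z0)) (dotv g (z - z0)).
by move=> *; lra.
Qed.

End OneStep.

(* [S] accumulates the terms [A_(i+1)^2 / a_i^4]. *)
Definition aep_invariant (z0 : 'rV[R]_d) (k : nat) (z v : 'rV[R]_d) (A : R) :=
  [/\ H z v, 0 <= A & exists S, [/\ 0 <= S,
    potential z0 z v A <= - (S / (4 * L2 ^+ 2)) & k%:R ^+ 5 <= 16 * S * A ^+ 2]].

Lemma aep_invariant0 z0 v0 : H z0 v0 -> aep_invariant z0 0 z0 v0 0.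
Proof.
move=> h; split=> //; exists 0; split=> //.
  by rewrite /potential !expr0n /= !mul0r addr0 oppr0.
by rewrite !expr0n /= mulr0.
Qed.

Lemma aep_invariantS z0 k z v A a x :
  aep_invariant z0 k z v A -> 0 < a -> H x (trial_dual F z0 z v A a x) ->
  1 <= merit F L2 z0 z v A a x <= Num.sqrt 2 ->
  aep_invariant z0 k.+1 x (trial_dual F z0 z v A a x) (A + a).
Proof.
move=> [zv A0 [S [S0 VS kS]]] a0 xp mx.
have A'0 : 0 < A + a by rewrite ltr_wpDl.
split; [by []|exact: ltW|exists (S + (A + a) ^+ 2 / a ^+ 4)]; split.
- by rewrite addr_ge0// divr_ge0 ?exprn_ge0// ltW.
- apply: le_trans (potential_decrease A0 a0 zv xp mx) _.
  have -> : (S + (A + a) ^+ 2 / a ^+ 4) / (4 * L2 ^+ 2) =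
      S / (4 * L2 ^+ 2) + (A + a) ^+ 2 / (4 * L2 ^+ 2 * a ^+ 4).
    by field; rewrite !gt_eqF.
  by rewrite opprD lerD2r.
- by rewrite -natr1; exact: step_growth.
Qed.

Lemma aep_invariant_bound z0 zstar k z v A : H zstar (- F zstar) ->
  aep_invariant z0 k z v A ->
  A * enorm (F z + v) <= 2 * enorm (z0 - zstar) /\
  k%:R ^+ 5 <= 32 * L2 ^+ 2 * enorm (z0 - zstar) ^+ 2 * A ^+ 2.
Proof.
move=> hs [zv A0 [S [S0 VS kS]]].
have := Hmono zv hs; have := Fmono z zstar.
set g := F z + v; set D := enorm (z0 - zstar) => m1 m2.
have gz : - (enorm g * D) <= dotv g (z - z0).
  have := dotv_le_enorm g (z0 - zstar); rewrite -/D.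
  have : 0 <= dotv g (z - zstar) by move: m1 m2; rewrite /g !dotvE; lra.
  by clearbody g; rewrite !dotvE; lra.
move: VS; rewrite /potential -/g -enorm_sqr => VS.
have S' : 0 <= S / (4 * L2 ^+ 2) by rewrite divr_ge0// mulr_ge0// sqr_ge0.
have D0 : 0 <= D := enorm_ge0 _.
have g0 : 0 <= enorm g := enorm_ge0 _.
(* In [t = A * enorm g], nonpositivity of the quadratic gives the first bound, and its minimum
   [- D^2 / 2] limits [S] for the second. *)
have T : (A * enorm g) ^+ 2 / 2 - A * enorm g * D <= - (S / (4 * L2 ^+ 2)).
  by apply: le_trans VS; have := ler_wpM2l A0 gz; rewrite exprMn; lra.
move: T; move: (A * enorm g) (mulr_ge0 A0 g0) => t t0 T.
split.
  have [//|ht] := leP t (2 * D).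
  have : 0 < t * (t - 2 * D) by rewrite mulr_gt0//; lra.
  by rewrite expr2 in T; lra.
apply: le_trans kS _; rewrite ler_wpM2r ?sqr_ge0//.
have : S / (4 * L2 ^+ 2) <= D ^+ 2 / 2.
  by have := sqr_ge0 (t - D); rewrite sqrrB; lra.
by rewrite ler_pdivrMr ?mulr_gt0 ?exprn_gt0//; lra.
Qed.

(** The bound is on [k.+1] because an iterate with residual above [eps] may still be updated once
    more; there [A <= 2 * D / eps]. *)
Lemma aep_invariant_count z0 zstar (eps : R) k z v A : H zstar (- F zstar) ->
  0 < eps -> eps < enorm (F z + v) -> 0 < enorm (z0 - zstar) ->
  aep_invariant z0 k z v A ->
  k.+1%:Z <= Num.ceil ((16 * L2 * enorm (z0 - zstar) ^+ 2 / eps) `^ (2 / 5)).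
Proof.
move=> hs eps0 ge D0 inv; have [ADk kA] := aep_invariant_bound hs inv.
have A0 : 0 <= A by case: inv.
move: ge D0 ADk kA; set g := enorm _; set D := enorm _ => ge D0 AD kA.
suff : k%:R < (16 * L2 * D ^+ 2 / eps) `^ (2 / 5).
  by move=> kY; rewrite -addn1 PoszD lezD1 -(ltr_int R) (lt_le_trans kY)// ceil_ge.
apply: lt_powR_two_fifths => //; first by rewrite divr_gt0 ?mulr_gt0 ?exprn_gt0.
have Ae : A <= 2 * D / eps.
  by rewrite ler_pdivlMr//; apply: le_trans AD; rewrite ler_wpM2l// ltW.
apply: le_lt_trans kA _.
apply: (@le_lt_trans _ _ (32 * L2 ^+ 2 * D ^+ 2 * (2 * D / eps) ^+ 2)).
  apply: ler_wpM2l; first by rewrite mulr_ge0 ?sqr_ge0// mulr_ge0 ?sqr_ge0.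
  rewrite lerXn2r ?nnegrE//.
  by rewrite divr_ge0 ?mulr_ge0// ltW.
(* The factors 256 and 128 leave room for a strict inequality, which is what yields [k.+1] below the
   ceiling. *)
rewrite -subr_gt0.
have -> : (16 * L2 * D ^+ 2 / eps) ^+ 2 - 32 * L2 ^+ 2 * D ^+ 2 * (2 * D / eps) ^+ 2
   = 128 * (L2 * D ^+ 2 / eps) ^+ 2 by ring.
by rewrite mulr_gt0// exprn_gt0// divr_gt0// mulr_gt0// exprn_gt0.
Qed.

(** If [z0 = zstar], the fifth-power bound would read [k.+1%:R ^+ 5 <= 0]; so no update is ever
    accepted in that case. *)
Lemma aep_invariantS_anchor_neq z0 zstar k z v A : H zstar (- F zstar) ->
  aep_invariant z0 k.+1 z v A -> 0 < enorm (z0 - zstar).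
Proof.
move=> hs /(aep_invariant_bound hs)[_]; rewrite lt_def enorm_ge0 andbT.
apply: contraTneq => ->; rewrite expr0n mulr0 mul0r -ltNge.
by rewrite exprn_gt0.
Qed.

End Step.

(** * The merit function *)

Section LineSearch.
Context {R : realType} {d : nat}.
Context (F : 'rV[R]_d -> 'rV[R]_d) (L2 : R) (L2_gt0 : 0 < L2).
Hypothesis Fmono : monotone_map F.
Hypothesis Fdiff : forall z : 'rV[R]_d, differentiable F z.
Hypothesis Flip : forall z z' : 'rV[R]_d,
  (opnorm (fun x => 'd F z x - 'd F z' x)%R <= (L2 * enorm (z - z'))%:E)%E.
Context (H : 'rV[R]_d -> set 'rV[R]_d) (Hmono : monotone_op H).

(** The difference splits into the Taylor error at [w1] of the model based at [w2], and the change
    of differential applied to [y - w1]. *)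
Lemma affine_model_lipschitz w1 w2 y :
  enorm (affine_model F w1 y - affine_model F w2 y) <=
  L2 * enorm (w1 - w2) * (enorm (w1 - w2) / 2 + enorm (y - w1)).
Proof.
have -> : affine_model F w1 y - affine_model F w2 y =
    (F w1 - affine_model F w2 w1) + ('d F w1 (y - w1) - 'd F w2 (y - w1)).
  have split2 (D1 D2 : {linear 'rV[R]_d -> 'rV[R]_d}) f1 f2 :
      f1 + D1 (y - w1) - (f2 + D2 (y - w2)) =
      (f1 - (f2 + D2 (w1 - w2))) + (D1 (y - w1) - D2 (y - w1)).
    rewrite -[y - w2](subrKA w1) [D2 (_ + _)]linearD.
    by apply/rowP => i; rewrite !mxE; ring.
  exact: split2.
apply: le_trans (enormD _ _) _.
have := taylor_bound L2_gt0 Fdiff Flip w1 w2.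
have := diff_lipschitz Flip w1 w2 (y - w1); lra.
Qed.

Context (z0 z v : 'rV[R]_d) (A : R) (A_ge0 : 0 <= A).
Let g := F z + v.
Let M := enorm (z0 - z - A *: g).
Let N := enorm (z0 - z).
Notation half a := (half_point F z0 z v A a).
Notation anch a := (anchored z0 A a z).

Lemma anchoredE a : 0 < a -> anch a = z + (a / (A + a)) *: (z0 - z).
Proof.
move=> a0; have A'n : A + a != 0 by rewrite gt_eqF// ltr_wpDl.
by apply/rowP => i; rewrite !mxE; field.
Qed.

Lemma half_pointE a : 0 < a -> half a = z + (a / (A + a)) *: (z0 - z - A *: g).
Proof.
move=> a0; have A'n : A + a != 0 by rewrite gt_eqF// ltr_wpDl.
rewrite /half_point -/g; clearbody g.
by apply/rowP => i; rewrite !mxE; field.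
Qed.

Lemma ratio_norm_le1 a : 0 < a -> `|a / (A + a)| <= 1.
Proof.
move=> a0; have A'0 : 0 < A + a by rewrite ltr_wpDl.
by rewrite gtr0_norm ?divr_gt0// ler_pdivrMr// mul1r lerDr.
Qed.

(** The difference is [(a - b) A / ((A + a) (A + b))], where [A / (A + a) <= 1] and
    [A + b >= al]. *)
Lemma ratio_lipschitz (al a b : R) : 0 < al -> al <= a -> al <= b ->
  `|a / (A + a) - b / (A + b)| <= `|a - b| / al.
Proof.
move=> al0 ala alb; have a0 := lt_le_trans al0 ala; have b0 := lt_le_trans al0 alb.
have Aa : 0 < A + a by rewrite ltr_wpDl.
have Ab : 0 < A + b by rewrite ltr_wpDl.
have -> : a / (A + a) - b / (A + b) = (a - b) * ((A / (A + a)) / (A + b)).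
  by field; rewrite !gt_eqF.
rewrite normrM ler_wpM2l ?normr_ge0// ger0_norm; last first.
  by rewrite !divr_ge0// ltW.
rewrite -[leRHS]mul1r ler_pM ?divr_ge0 ?invr_ge0 ?(ltW Aa) ?(ltW Ab)//.
  by rewrite ler_pdivrMr// mul1r lerDl ltW.
by rewrite lef_pV2 ?posrE// (le_trans alb)// lerDr.
Qed.

Lemma anchored_near a : 0 < a -> enorm (anch a - z) <= N.
Proof.
move=> a0; rewrite anchoredE// addrAC subrr add0r enormZ -[leRHS]mul1r.
by rewrite ler_wpM2r ?enorm_ge0// ratio_norm_le1.
Qed.

Lemma half_point_near a : 0 < a -> enorm (half a - z) <= M.
Proof.
move=> a0; rewrite half_pointE// addrAC subrr add0r enormZ -[leRHS]mul1r.
by rewrite ler_wpM2r ?enorm_ge0// ratio_norm_le1.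
Qed.

Lemma anchored_lipschitz (al a b : R) : 0 < al -> al <= a -> al <= b ->
  enorm (anch a - anch b) <= `|a - b| / al * N.
Proof.
move=> al0 ala alb; rewrite !anchoredE ?(lt_le_trans al0)//.
rewrite opprD addrACA subrr add0r -scalerBl enormZ.
by rewrite ler_wpM2r ?enorm_ge0// ratio_lipschitz.
Qed.

Lemma half_point_lipschitz (al a b : R) : 0 < al -> al <= a -> al <= b ->
  enorm (half a - half b) <= `|a - b| / al * M.
Proof.
move=> al0 ala alb; rewrite !half_pointE ?(lt_le_trans al0)//.
rewrite opprD addrACA subrr add0r -scalerBl enormZ.
by rewrite ler_wpM2r ?enorm_ge0// ratio_lipschitz.
Qed.

(* Nonexpansiveness of the resolvent of [a (P + H)], at the points
   [x = J (anch a)] and [y = J (y + a (P y + u))]. *)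
Lemma trial_compare a x y u : 0 < a -> H x (trial_dual F z0 z v A a x) -> H y u ->
  enorm (x - y) <= enorm (anch a - y - a *: (affine_model F (half a) y + u)).
Proof.
move=> a0 xp yu; apply: dotv_self_le_enorm.
have := Hmono xp yu; rewrite /trial_dual; set w := half a; set c := anch a.
have dF := diff_monotone L2_gt0 Fmono Fdiff Flip w (x - y).
have split1 (D : {linear 'rV[R]_d -> 'rV[R]_d}) f :
    f + D (x - w) = f + D (y - w) + D (x - y).
  by rewrite -[x - w](subrKA y) linearD addrA addrAC.
have -> : affine_model F w x = affine_model F w y + 'd F w (x - y) by exact: split1.
move: (affine_model F w y) => P; rewrite -(pmulr_rge0 _ a0) -dotvZl => mono.
have aD := mulr_ge0 (ltW a0) dF.
suff : dotv (c - y - a *: (P + u)) (x - y) - dotv (x - y) (x - y) =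
    dotv (a *: (a^-1 *: (c - x) - (P + 'd F w (x - y)) - u)) (x - y)
    + a * dotv ('d F w (x - y)) (x - y) by lra.
rewrite -dotvZl -dotvDl -dotvNl -dotvDl; congr (dotv _ _).
clearbody c; move: ('d F w _) => D; apply/rowP => i; rewrite !mxE; field.
by rewrite gt_eqF.
Qed.

Hypothesis zv : H z v.
Variable abar : R.
Let sigma := N + abar * (L2 / 2 * M ^+ 2 + enorm g).

(** Comparison with the graph point [(z, v)] keeps all trial points for steps up to [abar] in one
    ball. *)
Lemma trial_near a x : 0 < a -> a <= abar -> H x (trial_dual F z0 z v A a x) ->
  enorm (x - z) <= sigma.
Proof.
move=> a0 aa xp; apply: le_trans (trial_compare a0 xp zv) _.
apply: le_trans (enormD _ _) _; rewrite enormN enormZ gtr0_norm//.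
apply: lerD; first exact: anchored_near.
apply: (@le_trans _ _ (abar * enorm (affine_model F (half a) z + v))).
  by rewrite ler_wpM2r ?enorm_ge0.
apply: ler_wpM2l; first by rewrite ltW// (lt_le_trans a0).
have -> : affine_model F (half a) z + v = affine_model F (half a) z - F z + g.
  by rewrite /g addrA subrK.
apply: le_trans (enormD _ _) _; rewrite lerD2r enormB.
apply: le_trans (taylor_bound L2_gt0 Fdiff Flip _ _) _.
rewrite ler_wpM2l ?divr_ge0 ?(ltW L2_gt0)// lerXn2r ?nnegrE ?enorm_ge0//.
by rewrite enormB half_point_near.
Qed.

Lemma trial_gap a x : 0 < a -> a <= abar -> H x (trial_dual F z0 z v A a x) ->
  enorm (x - half a) <= sigma + M.
Proof.
move=> a0 aa xp; apply: le_trans (enorm_dist _ _ z) _.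
by apply: lerD; [exact: trial_near xp | exact: half_point_near].
Qed.

Lemma merit_small : exists2 C, 0 < C & forall a x, 0 < a -> a <= abar ->
  H x (trial_dual F z0 z v A a x) -> merit F L2 z0 z v A a x <= C * a.
Proof.
(* The absolute value and the added 1 make the constant positive whatever the sign of [abar]. *)
exists (1 + L2 * `|sigma + M|) => [|a x a0 aa xp].
  by rewrite ltr_pwDl// mulr_ge0// ltW.
have := ler_wpM2l (mulr_ge0 (ltW L2_gt0) (ltW a0)) (trial_gap a0 aa xp).
have := ler_wpM2l (mulr_ge0 (ltW L2_gt0) (ltW a0)) (ler_norm (sigma + M)).
rewrite /merit; nra.
Qed.

(** Here [kap] is a Lipschitz constant for the half points and [tau] one for the trial points; the
    terms of [tau] come from moving the anchored point, rescaling the dual by [a / b], and changing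
    the affine model. *)
Lemma merit_lipschitz (al : R) : 0 < al ->
  exists2 C, 0 < C & forall a b x y, al <= a <= abar -> al <= b <= abar ->
    H x (trial_dual F z0 z v A a x) -> H y (trial_dual F z0 z v A b y) ->
    merit F L2 z0 z v A a x - merit F L2 z0 z v A b y <= C * `|a - b|.
Proof.
move=> al0.
pose kap := M / al.
pose tau := N / al + (N + sigma) / al + abar * (L2 * kap * (M + (sigma + M))).
exists (1 + `|L2 * ((sigma + M) + abar * (tau + kap))|).
  by rewrite ltr_pwDl.
move=> a b x y /andP[ala aa] /andP[alb ba] xp yp.
have a0 := lt_le_trans al0 ala; have b0 := lt_le_trans al0 alb.
have M0 : 0 <= M by exact: enorm_ge0.
have N0 : 0 <= N by exact: enorm_ge0.
have abar0 : 0 <= abar by rewrite ltW// (lt_le_trans a0).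
have kap0 : 0 <= kap by rewrite divr_ge0// ltW.
have s0 : 0 <= sigma := le_trans (enorm_ge0 _) (trial_near a0 aa xp).
set D := `|a - b|; have D0 : 0 <= D by rewrite normr_ge0.
have hw : enorm (half a - half b) <= kap * D.
  have -> : kap * D = D / al * M by rewrite /kap; ring.
  exact: half_point_lipschitz.
have hc := anchored_lipschitz al0 ala alb; rewrite -/D in hc.
have hw2 : enorm (half a - half b) <= 2 * M.
  apply: le_trans (enorm_dist _ _ z) _; rewrite mulr_natl.
  exact: lerD (half_point_near a0) (half_point_near b0).
have yw : enorm (y - half a) <= sigma + M.
  apply: le_trans (enorm_dist _ _ z) _.
  exact: lerD (trial_near b0 ba yp) (half_point_near a0).
have hP : enorm (affine_model F (half a) y - affine_model F (half b) y) <=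
    L2 * kap * (M + (sigma + M)) * D.
  apply: le_trans (affine_model_lipschitz _ _ _) _.
  have -> : L2 * kap * (M + (sigma + M)) * D =
    L2 * (kap * D) * (M + (sigma + M)) by ring.
  apply: ler_pM; rewrite ?mulr_ge0 ?addr_ge0 ?divr_ge0 ?enorm_ge0 ?(ltW L2_gt0)//.
    by rewrite ler_wpM2l// ltW.
  by apply: lerD yw; rewrite ler_pdivrMr// mulrC.
have hxy : enorm (x - y) <= tau * D.
  apply: le_trans (trial_compare a0 xp yp) _.
  have -> : anch a - y - a *: (affine_model F (half a) y + trial_dual F z0 z v A b y) =
    (anch a - anch b) + (1 - a / b) *: (anch b - y)
    - a *: (affine_model F (half a) y - affine_model F (half b) y).
    rewrite /trial_dual.
    move: (affine_model _ (half a) y) (affine_model _ (half b) y) (anch a) (anch b).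
    by move=> P1 P2 c1 c2; apply/rowP => i; rewrite !mxE; field; rewrite gt_eqF.
  apply: le_trans (enormD _ _) _; rewrite enormN enormZ gtr0_norm// /tau mulrDl mulrDl.
  have h1 : a * enorm (affine_model F (half a) y - affine_model F (half b) y) <=
      abar * (L2 * kap * (M + (sigma + M))) * D.
    rewrite -[leRHS]mulrA; apply: ler_pM => //; rewrite ?enorm_ge0//; exact: ltW.
  have h2 : enorm ((anch a - anch b) + (1 - a / b) *: (anch b - y)) <=
      N / al * D + (N + sigma) / al * D.
    apply: le_trans (enormD _ _) _; apply: lerD.
      by have -> : N / al * D = D / al * N by ring.
    rewrite enormZ.
    have -> : (N + sigma) / al * D = D / al * (N + sigma) by ring.
    apply: ler_pM; rewrite ?enorm_ge0//.
      have -> : 1 - a / b = (b - a) / b by field; rewrite gt_eqF.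
      rewrite normrM (distrC b) normfV (gtr0_norm b0) ler_wpM2l//.
      by rewrite lef_pV2 ?posrE.
    apply: le_trans (enorm_dist _ _ z) _.
    exact: lerD (anchored_near b0) (trial_near b0 ba yp).
  exact: lerD h2 h1.
have rr : enorm (x - half a) <= enorm (y - half b) + (tau + kap) * D.
  have -> : x - half a = (x - y) + ((y - half b) - (half a - half b)).
    by apply/rowP => i; rewrite !mxE; ring.
  apply: le_trans (enormD _ _) _; rewrite mulrDl addrCA; apply: lerD hxy _.
  apply: le_trans (enormD _ _) _; rewrite enormN; exact: lerD.
rewrite /merit -/D.
have yb := trial_gap b0 ba yp; have xa := trial_gap a0 aa xp.
move: rr yb xa (enorm_ge0 (x - half a)) (enorm_ge0 (y - half b)).
move: (enorm (x - half a)) (enorm (y - half b)) => r1 r2 rr r2s r1s r10 r20.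
have abD : a - b <= D by exact: ler_norm.
have tau0 : 0 <= tau.
  apply: addr_ge0; first exact: (addr_ge0 (divr_ge0 N0 (ltW al0))
    (divr_ge0 (addr_ge0 N0 s0) (ltW al0))).
  apply: mulr_ge0 abar0 (mulr_ge0 (mulr_ge0 (ltW L2_gt0) kap0) _).
  by rewrite addr_ge0// addr_ge0// mulr_ge0.
have tk : 0 <= (tau + kap) * D by rewrite mulr_ge0// addr_ge0.
have := product_lipschitz abD r10 D0 r1s rr (ltW b0) ba tk.
move=> /(ler_wpM2l (ltW L2_gt0)) h.
have -> : L2 * a * r1 - L2 * b * r2 = L2 * (a * r1 - b * r2) by ring.
apply: le_trans h _; rewrite mulrA mulrDl mul1r.
by apply: le_trans (ler_wpM2r D0 (ler_norm _)) _; rewrite lerDr.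
Qed.

End LineSearch.

(** * Termination *)

Section Termination.
Context {R : realType} {d : nat}.
Context (F : 'rV[R]_d -> 'rV[R]_d) (L2 : R) (L2_gt0 : 0 < L2).
Hypothesis Fmono : monotone_map F.
Hypothesis Fdiff : forall z : 'rV[R]_d, differentiable F z.
Hypothesis Flip : forall z z' : 'rV[R]_d,
  (opnorm (fun x => 'd F z x - 'd F z' x)%R <= (L2 * enorm (z - z'))%:E)%E.
Context (H : 'rV[R]_d -> set 'rV[R]_d) (Hmax : maximally_monotone H).
Context (z0 : 'rV[R]_d) (eps : R) (eps_gt0 : 0 < eps).

Lemma upper_trial_gt0 z v A : 0 < upper_trial F eps L2 z v A.
Proof.
by rewrite /upper_trial lt_max sqrtr_gt0 orbC divr_gt0// mulr_gt0.
Qed.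

(** Each entry of the maximum defining the upper trial makes one term of [residual_bound] at most
    [eps / 2]. *)
Lemma upper_trial_residual z v A x : 0 <= A ->
  merit F L2 z0 z v A (upper_trial F eps L2 z v A) x <= Num.sqrt 2 ->
  enorm (F x + trial_dual F z0 z v A (upper_trial F eps L2 z v A) x) <= eps.
Proof.
set a := upper_trial _ _ _ _ _ _ => A0 mx; have a0 : 0 < a := upper_trial_gt0 z v A.
apply: le_trans (residual_bound L2_gt0 Fdiff Flip A0 a0 mx) _.
have h1 : A / a * enorm (F z + v) <= eps / 2.
  have : 2 * A * enorm (F z + v) / eps <= a by rewrite le_max lexx.
  rewrite ler_pdivrMr// => h; rewrite mulrAC ler_pdivrMr//; lra.
have h2 : (1 + Num.sqrt 2) / (L2 * a ^+ 2) <= eps / 2.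
  have h : Num.sqrt (2 * (1 + Num.sqrt 2) / (L2 * eps)) <= a.
    by rewrite le_max lexx orbT.
  have q0 : 0 <= 2 * (1 + Num.sqrt 2) / (L2 * eps) :> R.
    by rewrite divr_ge0 ?mulr_ge0 ?addr_ge0 ?sqrtr_ge0// ltW.
  rewrite -ler_sqr ?nnegrE ?sqrtr_ge0 ?(ltW a0)// sqr_sqrtr// in h.
  rewrite ler_pdivrMr ?mulr_gt0// in h.
  rewrite ler_pdivrMr ?mulr_gt0 ?exprn_gt0//; lra.
lra.
Qed.

Variable Q : aep_state R d -> Prop.
Notation reaches := (always_reaches (aep_step F H z0 eps L2) Q).

(* [merit] is at most [C a], so [ap] stays bounded away from 0, and beyond that
   bound it is Lipschitz; hence it cannot climb from below 1 at [am] to above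
   [sqrt 2] at [ap] once [ap - am] is small. *)
Lemma bisection_terminates k z v A abar : H z v -> 0 <= A -> 0 < abar ->
  (forall a x, 0 < a -> trial_point F H z0 z v A a x ->
    1 <= merit F L2 z0 z v A a x <= Num.sqrt 2 ->
    reaches (Outer k.+1 x (trial_dual F z0 z v A a x) (A + a))) ->
  (exists2 x, trial_point F H z0 z v A abar x &
    Num.sqrt 2 < merit F L2 z0 z v A abar x) ->
  reaches (Bisect k z v A 0 abar).
Proof.
move=> zv A0 abar0 Hacc Hbar.
have tpH a x : 0 < a -> trial_point F H z0 z v A a x ->
    H x (trial_dual F z0 z v A a x).
  by move=> a0 [/(trial_inclusionP F H z0 z v A x a0)].
have [C1 C10 hC1] := merit_small L2_gt0 Fmono Fdiff Flip Hmax.1 z0 A0 zv abar.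
have al0 : 0 < C1^-1 / 2 by rewrite divr_gt0// invr_gt0.
have [C2 C20 hC2] :=
  merit_lipschitz L2_gt0 Fmono Fdiff Flip Hmax.1 z0 A0 zv abar al0.
have s1 : 1 < Num.sqrt 2 :> R by rewrite -[ltLHS]sqrtr1 ltr_sqrt// ltr1n.
(* On an interval of length at most [dl], [C1^-1 < ap] keeps [am] at least [C1^-1 / 2], and there
   the merit rises by at most [sqrt 2 - 1]. *)
pose dl := Num.min (C1^-1 / 2) ((Num.sqrt 2 - 1) / C2).
have dl0 : 0 < dl by rewrite lt_min al0 divr_gt0// subr_gt0.
(* Each halving lowers [n]. No trial has been made at [am = 0], so what is known about [am] is
   conditional on [0 < am]. *)
suff main n : forall am ap, 0 <= am -> am < ap -> ap <= abar ->
    ap - am <= dl * 2 ^+ n ->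
    (0 < am -> exists2 x, trial_point F H z0 z v A am x &
      merit F L2 z0 z v A am x < 1) ->
    (exists2 x, trial_point F H z0 z v A ap x &
      Num.sqrt 2 < merit F L2 z0 z v A ap x) ->
    reaches (Bisect k z v A am ap).
  have [n hn] : exists n : nat, abar / dl < 2 ^+ n.
    exists (Num.truncn (abar / dl)).+1.
    apply: lt_le_trans (truncnS_gt _) _.
    by rewrite -natrX ler_nat ltnW// ltn_expl.
  apply: (main n) => //; first by rewrite subr0 mulrC -ler_pdivrMr// ltW.
  by rewrite ltxx.
elim: n => [|n IH] am ap am0 amp apb gap lo [y ty my].
  exfalso; have ap0 : 0 < ap by exact: le_lt_trans amp.
  have yp := tpH _ _ ap0 ty.
  have apC : C1^-1 < ap.
    rewrite -[ltLHS]mul1r ltr_pdivrMr// mulrC.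
    exact: lt_trans s1 (lt_le_trans my (hC1 _ _ ap0 apb yp)).
  move: gap; rewrite expr0 mulr1 le_min => /andP[g1 g2].
  have am_al : C1^-1 / 2 <= am by lra.
  have am_gt0 := lt_le_trans al0 am_al.
  have [x tx mx] := lo am_gt0; have xp := tpH _ _ am_gt0 tx.
  have := hC2 ap am y x _ _ yp xp.
  rewrite am_al (le_trans (ltW amp) apb) apb (le_trans am_al (ltW amp)).
  move=> /(_ isT isT); rewrite gtr0_norm ?subr_gt0// mulrC => lip.
  rewrite ler_pdivlMr// in g2.
  by have := lt_le_trans (ltrB my mx) (le_trans lip g2); rewrite ltxx.
set a := (am + ap) / 2.
have a0 : 0 < a by rewrite /a; lra.
have am_a : am < a by rewrite midf_lt.
have a_ap : a < ap by rewrite midf_lt.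
have aab : a <= abar := le_trans (ltW a_ap) apb.
have g1 : ap - a <= dl * 2 ^+ n by move: gap; rewrite exprS /a; lra.
have g2 : a - am <= dl * 2 ^+ n by move: gap; rewrite exprS /a; lra.
apply: reaches_next.
  have [x tx] := trial_point_exists L2_gt0 Fmono Fdiff Flip Hmax z0 z v A a0.
  have [m1|m1] := ltP (merit F L2 z0 z v A a x) 1.
    by exists (Bisect k z v A a ap); exact: step_raise tx m1.
  have [m2|m2] := leP (merit F L2 z0 z v A a x) (Num.sqrt 2).
    exists (Outer k.+1 x (trial_dual F z0 z v A a x) (A + a)).
    by apply: step_accept tx _; rewrite m1.
  by exists (Bisect k z v A am a); exact: step_lower tx m2.
move=> s' st; inversion st as [| | | |? ? ? ? ? ? x' a' tx mx|? ? ? ? ? ? x' a' tx mx|? ? ? ? ? ? x' a' tx mx]; subst.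
- exact: (IH a ap (ltW a0) a_ap apb g1 (fun _ => ex_intro2 _ _ x' tx mx)
    (ex_intro2 _ _ y ty my)).
- exact: (IH am a am0 am_a aab g2 lo (ex_intro2 _ _ x' tx mx)).
- exact: Hacc.
Qed.

End Termination.

(** * Returned residuals and the budget of outer iterations *)

Lemma res_tan_le (R : realType) (d : nat) (F : 'rV[R]_d -> 'rV[R]_d)
    (H : 'rV[R]_d -> set 'rV[R]_d) (z v : 'rV[R]_d) (eps : R) :
  H z v -> enorm (F z + v) <= eps -> (res_tan F H z <= eps%:E)%E.
Proof.
move=> zv le; apply: (@le_trans _ _ (enorm (F z + v))%:E); last by rewrite lee_fin.
by apply: ereal_inf_lbound; exists v.
Qed.

Theorem theorem4p4 (R : realType) (d : nat) (F : 'rV[R]_d -> 'rV[R]_d)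
    (H : 'rV[R]_d -> set 'rV[R]_d) (zstar z0 : 'rV[R]_d) (eps L2 : R)
    (HL2 : 0 < L2)
    (Fmono : monotone_map F)
    (Fdiff : forall z : 'rV[R]_d, differentiable F z)
    (Flip : forall z z' : 'rV[R]_d,
      (opnorm (fun x => 'd F z x - 'd F z' x)%R <= (L2 * enorm (z - z'))%:E)%E)
    (Hmax : maximally_monotone H)
    (Hzstar : [set F zstar + u | u in H zstar] 0)
    (Hz0 : op_dom H z0)
    (Heps : 0 < eps) :
  aep_returns F H z0 eps L2 (fun k zhat =>
    (res_tan F H zhat <= eps%:E)%E /\
    k%:Z <= Num.ceil ((16 * L2 * enorm (z0 - zstar) ^+ 2 / eps) `^ (2 / 5))).
Proof.
rewrite /aep_returns; set T := Num.ceil _; set Q := (fun s => _).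
have Hm := Hmax.1.
have hs : H zstar (- F zstar).
  by case: Hzstar => u hu /addr0_eq ->.
have T0 : 0 <= T by rewrite -(ceil0 R) ceil_le ?powR_ge0.
(* [n] limits the remaining accepted updates; at [n = 0] the two bounds on [k] contradict each
   other. *)
have main n : forall k z v A, aep_invariant F L2 H z0 k z v A -> k%:Z <= T ->
    T < k%:Z + n%:Z -> always_reaches (aep_step F H z0 eps L2) Q (Outer k z v A).
  elim: n => [|n IH] k z v A inv kT Tk; first by move: kT; rewrite leNgt -[k%:Z]addr0 Tk.
  have [zv A0 _] := inv.
  have a0 := upper_trial_gt0 F HL2 Heps z v A.
  have [x tx] := trial_point_exists HL2 Fmono Fdiff Flip Hmax z0 z v A a0.
  apply: reaches_next.
    have [le|lt] := leP (enorm (F z + v)) eps; first by exists (Returned k z); exact: step_stop.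
    have [m|m] := leP (merit F L2 z0 z v A (upper_trial F eps L2 z v A) x) (Num.sqrt 2).
      by exists (Returned k x); exact: step_upper_return tx m.
    by exists (Bisect k z v A 0 (upper_trial F eps L2 z v A)); exact: step_upper_bisect tx m.
  move=> s' st; inversion st as [|? ? ? ? le|? ? ? ? y a lt ty m|? ? ? ? y a lt ty m| | |]; subst.
  - by apply: reaches_now; split=> //; exact: res_tan_le zv le.
  - apply: reaches_now; split=> //.
    apply: (res_tan_le _ (upper_trial_residual HL2 Fdiff Flip Heps A0 m)).
    exact/trial_inclusionP/(ty.1).
  - apply: (bisection_terminates HL2 Fmono Fdiff Flip Hmax zv A0 a0) => [b w b0 tw mw|].
      (* The failed stopping test at the old iterate bounds [k.+1]; the invariant at the new one
         supplies [z0 != zstar], which that bound needs. *)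
      have inv' := aep_invariantS HL2 Fmono Fdiff Flip Hm inv b0
        ((trial_inclusionP F H z0 z v A w b0).1 tw.1) mw.
      have D0 := aep_invariantS_anchor_neq HL2 Fmono Hm hs inv'.
      apply: IH inv' (aep_invariant_count HL2 Fmono Hm hs Heps lt D0 inv) _.
      by move: Tk; rewrite -!PoszD addnS addSn.
    by exists y.
apply: reaches_next; first by have [v0 zv0] := Hz0; exists (Outer 0 z0 v0 0); exact: step_init.
move=> s' st; inversion st as [v0 zv0| | | | | |]; subst.
apply: (main `|T|.+1); [exact: aep_invariant0 | exact: T0 |].
by rewrite add0r -addn1 PoszD gez0_abs// ltzD1.
Qed.
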